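(* Let $k\ge0$ be an integer and let $f:[a,b]\to\mathbb{R}$, with evaluations $f(x_i)$, $i=1,\ldots,n$, arbitrary. Suppose that for all $x\in[a,b]\setminus\{x_1,\ldots,x_n\}$: if $x>x_{k+1}$, then $$f[x_{i-k},\ldots,x_i,x]=0,$$ where $i$ is the smallest index such that $x_i>x$ (with $i=n$ when $x>x_n$); and if $x<x_{k+1}$, then $$f[x_1,\ldots,x_{k+1},x]=0.$$ Then $f\in\mathcal{H}^k_n=\mathrm{span}\{h^k_1,\ldots,h^k_n\}$, that is, $f$ must be the $k$th degree discrete spline with knots in $\{x_{k+1},\ldots,x_{n-1}\}$ that interpolates the values $f(x_1),\ldots,f(x_n)$ at $x_1,\ldots,x_n$.
   Context: Design points: $a\le x_1<\cdots<x_n\le b$ with $n\ge k+1$. Empty products equal 1. Divided differences: $f[z]=f(z)$ and $f[z_1,\ldots,z_{r+1}]=(f[z_2,\ldots,z_{r+1}]-f[z_1,\ldots,z_r])/(z_{r+1}-z_1)$ for distinct points (in any order). Falling factorial basis on $[a,b]$: $h^k_j(x)=\frac1{(j-1)!}\prod_{\ell=1}^{j-1}(x-x_\ell)$ for $j=1,\ldots,k+1$, and $h^k_j(x)=\frac1{k!}\prod_{\ell=j-k}^{j-1}(x-x_\ell)\cdot1\{x>x_{j-1}\}$ for $j=k+2,\ldots,n$. The space $\mathcal{H}^k_n$ is called the space of $k$th degree discrete splines with knots in $\{x_{k+1},\ldots,x_{n-1}\}$; each set of $n$ values has exactly one interpolant in it. *)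

(* Defs.v *)
From mathcomp Require Import all_boot all_order all_algebra.
From mathcomp Require Import reals.

Set Implicit Arguments.
Unset Strict Implicit.
Unset Printing Implicit Defensive.

Import Order.TTheory GRing.Theory Num.Theory.

Local Open Scope ring_scope.

(* Conventions: design points are a function [x : nat -> R] of which only the
   values [x 1, ..., x n] are relevant (1-based indexing), and a function on
   [a, b] is represented by an [R -> R] of which only the values on [a, b] are
   relevant. *)

(* f[s_m, ..., s_(m+r)] *)
Fixpoint divdiff_rec (R : fieldType) (f : R -> R) (s : seq R) (m r : nat) : R :=
  if r is r'.+1 then
    (divdiff_rec f s m.+1 r' - divdiff_rec f s m r') / (s`_(m + r) - s`_m)
  else f s`_m.

(* Meaningful when [s] is nonempty with pairwise distinct entries. *)
Definition divdiff (R : fieldType) (f : R -> R) (s : seq R) : R :=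
  divdiff_rec f s 0 (size s).-1.

Lemma divdiff1 (R : fieldType) (f : R -> R) (z : R) : divdiff f [:: z] = f z.
Proof. by []. Qed.

Lemma eq_divdiff_rec (R : fieldType) (f : R -> R) (s t : seq R) (p q r : nat) :
  (forall i, (i <= r)%N -> s`_(p + i) = t`_(q + i)) ->
  divdiff_rec f s p r = divdiff_rec f t q r.
Proof.
elim: r p q => [|r IHr] p q Hst /=.
  by have := Hst 0 isT; rewrite !addn0 => ->.
have Hhead := Hst 0 isT; rewrite !addn0 in Hhead.
rewrite Hst // Hhead (IHr p q) ?(IHr p.+1 q.+1) // => i le_ir.
  by rewrite !addSnnS Hst.
by rewrite Hst // ltnW.
Qed.

Lemma divdiff_cons_rcons (R : fieldType) (f : R -> R) (z z' : R) (s : seq R) :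
  divdiff f (z :: rcons s z') =
  (divdiff f (rcons s z') - divdiff f (z :: s)) / (z' - z).
Proof.
rewrite /divdiff /= !size_rcons /= nth_rcons ltnn eqxx.
congr ((_ - _) / _); apply: eq_divdiff_rec => i le_is; rewrite !add0n //.
by rewrite -rcons_cons nth_rcons /= ltnS le_is.
Qed.

(* The falling factorial basis h^k_j, 1 <= j <= n. *)
Definition ffbasis (R : realFieldType) (k : nat) (x : nat -> R) (j : nat) (t : R)
    : R :=
  if (j <= k.+1)%N then
    ((j.-1)`!%:R)^-1 * \prod_(1 <= l < j) (t - x l)
  else
    (k`!%:R)^-1 * \prod_(j - k <= l < j) (t - x l) * (x j.-1 < t)%R%:R.

(* g, as a function on [a, b], belongs to span {h^k_1, ..., h^k_n}. *)
Definition discrete_spline (R : realFieldType) (a b : R) (k n : nat)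
    (x : nat -> R) (g : R -> R) : Prop :=
  exists c : nat -> R, forall t, t \in `[a, b] ->
    g t = \sum_(1 <= j < n.+1) c j * ffbasis k x j t.

(* i is the smallest index in {1, ..., n} with x_i > t, or i = n if t > x_n. *)
Definition next_index (R : realFieldType) (n : nat) (x : nat -> R) (t : R)
    (i : nat) : Prop :=
  [/\ (1 <= i <= n)%N, t < x i &
      forall j, (1 <= j <= n)%N -> t < x j -> (i <= j)%N]
  \/ (i = n /\ x n < t).

(* Main.v *)
Require Import Defs.
From mathcomp Require Import all_boot all_order all_algebra.
From mathcomp Require Import reals.
From mathcomp Require Import ring zify.

Set Implicit Arguments.
Unset Strict Implicit.
Unset Printing Implicit Defensive.

Import Order.TTheory GRing.Theory Num.Theory.

Local Open Scope ring_scope.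

(** A vanishing divided difference says that the value at the last point is
    forced by the others: [f[s, t] = 0] holds exactly when [f t] is the value at
    [t] of the polynomial [q] of degree less than [size s] interpolating [f] on
    [s]. Indeed [f[s, t]] is the coefficient of degree [size s] in the
    interpolant of [f] on [s, t] ([divdiff_interpolant]); when it vanishes, this
    interpolant has the degree of [q] and agrees with it on [s], hence equals it
    ([divdiff_eq0_extrapolate]).

    It remains to see that a discrete spline [g] follows the same extrapolation
    rule. Between consecutive design points, say on the interval from
    [x (i - 1)] to [x i], [g] is a polynomial [p_i] of degree at most [k], and
    [p_j - p_(j-1)] is a multiple of the product of the [k] factors
    [t - x l], for [j - k <= l < j]. So the transitions from
    the piece containing [x m] up to [p_i] leave the value at [x m] unchanged
    as long as [i - k <= m <= i], and [p_i] interpolates [g] not only at [x i] but at all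
    the [k + 1] points [x (i - k), ..., x i] ([spline_piece_design]).

    Hence a spline agreeing with [f] at the design points agrees with it
    everywhere. Such a spline exists because the matrix of the values
    [h_j (x i)] is triangular with nonzero diagonal. *)

(** * Divided differences and interpolating polynomials *)

(** Neville's recursion: the interpolants on [s_m, ..., s_(m+r)] and on
    [s_(m+1), ..., s_(m+r+1)] are combined with affine weights, and the leading
    coefficients then obey the recursion that defines divided differences. *)
Lemma divdiff_rec_interpolant (F : fieldType) (f : F -> F) (s : seq F)
    (m r : nat) :
  uniq s -> (m + r < size s)%N ->
  exists p : {poly F},
    [/\ (size p <= r.+1)%N, p`_r = divdiff_rec f s m r &
        forall i, (m <= i <= m + r)%N -> p.[s`_i] = f s`_i].
Proof.
move=> s_uniq; elim: r m => [|r IHr] m lt_mr.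
  exists (f s`_m)%:P; split; rewrite ?size_polyC ?leq_b1 ?coefC //.
  by move=> i ?; have -> : i = m; [lia | rewrite hornerC].
have [|p [size_p lead_p p_f]] := IHr m; first by lia.
have [|q [size_q lead_q q_f]] := IHr m.+1; first by lia.
have d_neq0 : s`_(m + r.+1) - s`_m != 0.
  rewrite subr_eq0 nth_uniq //; first by lia.
  by apply: leq_trans lt_mr; lia.
exists ((s`_(m + r.+1) - s`_m)^-1 *:
        (('X - (s`_m)%:P) * q - ('X - (s`_(m + r.+1))%:P) * p)).
have size_XsubC_mul (u : F) (w : {poly F}) :
    (size w <= r.+1)%N -> (size (('X - u%:P) * w)%R <= r.+2)%N.
  by move=> ?; apply: leq_trans (size_polyMleq _ _) _; rewrite size_XsubC.
split.
- apply: leq_trans (size_scale_leq _ _) _.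
  apply: leq_trans (size_polyD _ _) _.
  by rewrite size_polyN geq_max !size_XsubC_mul.
- rewrite coefZ coefB !mulrBl !coefB !coefXM !coefCM /= lead_p lead_q.
  have -> : p`_r.+1 = 0 by apply: nth_default.
  have -> : q`_r.+1 = 0 by apply: nth_default.
  by rewrite !mulr0 !subr0 mulrC.
- move=> i le_mir; rewrite hornerZ hornerD hornerN !hornerM !hornerXsubC.
  have [->|neq_im] := eqVneq i m.
    by rewrite subrr mul0r p_f; [field | lia].
  have [->|neq_imr] := eqVneq i (m + r.+1)%N.
    by rewrite subrr mul0r q_f; [field | lia].
  by rewrite p_f ?q_f; [field | lia | lia].
Qed.

Lemma divdiff_interpolant (F : fieldType) (f : F -> F) (s : seq F) :
  uniq s -> (0 < size s)%N ->
  exists p : {poly F},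
    [/\ (size p <= size s)%N, p`_(size s).-1 = divdiff f s &
        {in s, forall z, p.[z] = f z}].
Proof.
move=> s_uniq s_gt0.
have [|p [size_p lead_p p_f]] :=
  @divdiff_rec_interpolant F f s 0 (size s).-1 s_uniq; first by lia.
exists p; split=> //; first by lia.
move=> z /[dup] z_s; rewrite -index_mem => lt_zs.
by rewrite -(nth_index 0 z_s) p_f // add0n /= -ltnS prednK.
Qed.

(** The vanishing leading coefficient brings the interpolant on [s, t] down to
    degree less than [size s], where [s] suffices to determine it. *)
Lemma divdiff_eq0_extrapolate (F : fieldType) (f : F -> F) (s : seq F) (t : F)
    (q : {poly F}) :
  uniq (rcons s t) -> divdiff f (rcons s t) = 0 ->
  (size q <= size s)%N -> {in s, forall z, q.[z] = f z} ->
  f t = q.[t].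
Proof.
move=> st_uniq dd0 size_q q_f.
have [|p [size_p lead_p p_f]] := @divdiff_interpolant F f (rcons s t) st_uniq.
  by rewrite size_rcons.
move: size_p lead_p; rewrite size_rcons dd0 /= => size_p lead_p.
have {}size_p : (size p <= size s)%N.
  apply/leq_sizeP => j; rewrite leq_eqVlt => /predU1P[<- //|lt_sj].
  by apply: nth_default; apply: leq_trans lt_sj.
rewrite -p_f ?mem_rcons ?mem_head //.
suff -> : p = q by [].
apply/eqP; rewrite -subr_eq0; apply/eqP.
apply: (@roots_geq_poly_eq0 _ _ s).
- apply/allP => z z_s; rewrite rootE hornerD hornerN q_f // p_f ?subrr //.
  by rewrite mem_rcons in_cons z_s orbT.
- by move: st_uniq; rewrite rcons_uniq => /andP[].
- apply: leq_trans (size_polyD _ _) _.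
  by rewrite size_polyN geq_max size_p.
Qed.

(** * Triangular systems and interpolation by splines *)

Lemma lower_triangular_solvable (F : fieldType) (n : nat) (A : nat -> nat -> F)
    (y : nat -> F) :
  (forall i j, (1 <= i < j)%N -> (j <= n)%N -> A i j = 0) ->
  (forall i, (1 <= i <= n)%N -> A i i != 0) ->
  exists c : nat -> F, forall i, (1 <= i <= n)%N ->
    \sum_(1 <= j < n.+1) c j * A i j = y i.
Proof.
elim: n => [|n IHn] A_lower A_diag; first by exists y; lia.
have [||c c_sol] := IHn.
- by move=> i j ? ?; apply: A_lower => //; lia.
- by move=> i ?; apply: A_diag; lia.
pose S := \sum_(1 <= j < n.+1) c j * A n.+1 j.
pose d := (y n.+1 - S) / A n.+1 n.+1.
exists (fun j => if j == n.+1 then d else c j) => i le_in.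
rewrite big_nat_recr //= eqxx.
rewrite (eq_big_nat _ _ (F2 := fun j => c j * A i j)); last first.
  by move=> j ?; rewrite ifF //; lia.
have [->|neq_in] := eqVneq i n.+1.
  rewrite /d divfK; last by apply: A_diag; lia.
  by rewrite addrC subrK.
by rewrite A_lower ?mulr0 ?addr0 ?c_sol //; lia.
Qed.

Lemma design_lt (R : realFieldType) (n : nat) (x : nat -> R) :
  (forall i, (1 <= i < n)%N -> x i < x i.+1) ->
  forall i j, (1 <= i < j)%N -> (j <= n)%N -> x i < x j.
Proof.
move=> x_incr i; elim=> [|j IHj] lt_ij le_jn; first by lia.
have [->|neq_ij] := eqVneq i j; first by apply: x_incr; lia.
by apply: (lt_trans (IHj _ _)); [lia | lia | apply: x_incr; lia].
Qed.

Lemma design_le (R : realFieldType) (n : nat) (x : nat -> R) :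
  (forall i, (1 <= i < n)%N -> x i < x i.+1) ->
  forall i j, (1 <= i <= j)%N -> (j <= n)%N -> x i <= x j.
Proof.
move=> x_incr i j le_ij le_jn.
have [-> //|neq_ij] := eqVneq i j.
by apply/ltW/(@design_lt _ _ _ x_incr); lia.
Qed.

Lemma prod_sub_eq0 (R : idomainType) (x : nat -> R) (p q m : nat) :
  (p <= m < q)%N -> \prod_(p <= l < q) (x m - x l) = 0.
Proof.
move=> le_pmq; apply/eqP; rewrite prodf_seq_eq0; apply/hasP; exists m.
  by rewrite mem_index_iota.
by rewrite subrr /=.
Qed.

(** For small [j] the zero [x i] of the product makes [h_j] vanish, for large
    [j] the truncation does. *)
Lemma ffbasis_lower (R : realFieldType) (k n : nat) (x : nat -> R) (i j : nat) :
  (forall l, (1 <= l < n)%N -> x l < x l.+1) ->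
  (1 <= i < j)%N -> (j <= n)%N -> ffbasis k x j (x i) = 0.
Proof.
move=> x_incr lt_ij le_jn; rewrite /ffbasis; case: ifP => le_jk.
  by rewrite prod_sub_eq0 ?mulr0.
by rewrite ltNge (@design_le _ _ _ x_incr) ?mulr0 //; lia.
Qed.

Lemma ffbasis_diag (R : realFieldType) (k n : nat) (x : nat -> R) (i : nat) :
  (forall l, (1 <= l < n)%N -> x l < x l.+1) ->
  (1 <= i <= n)%N -> ffbasis k x i (x i) != 0.
Proof.
move=> x_incr le_in.
have fact_neq0 (m : nat) : (m`!%:R : R)^-1 != 0.
  by rewrite invr_eq0 pnatr_eq0 -lt0n fact_gt0.
have prod_neq0 p : (0 < p)%N -> \prod_(p <= l < i) (x i - x l) != 0.
  move=> p_gt0; rewrite big_nat prodf_seq_neq0; apply/allP => l _.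
  apply/implyP => le_pli; rewrite subr_eq0 gt_eqF //.
  by apply: (@design_lt _ _ _ x_incr); lia.
rewrite /ffbasis; case: ifP => le_ik; first by rewrite mulf_neq0 ?prod_neq0.
rewrite (@design_lt _ _ _ x_incr) ?mulr1; [|lia|lia].
by rewrite mulf_neq0 ?prod_neq0 //; lia.
Qed.

Lemma ffbasis_interpolation (R : realFieldType) (k n : nat) (x : nat -> R)
    (y : nat -> R) :
  (forall l, (1 <= l < n)%N -> x l < x l.+1) ->
  exists c : nat -> R, forall i, (1 <= i <= n)%N ->
    \sum_(1 <= j < n.+1) c j * ffbasis k x j (x i) = y i.
Proof.
move=> x_incr.
apply: (@lower_triangular_solvable _ n (fun i j => ffbasis k x j (x i))).
- by move=> i j; apply: ffbasis_lower.
- by move=> i; apply: ffbasis_diag.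
Qed.

(** * Polynomial pieces of a discrete spline *)

(** The polynomial part of [h_j], by a single formula for both kinds of basis
    functions: they differ in whether [j - k] exceeds [1], and in which of
    [j - 1] and [k] counts the factors. *)
Definition ffpoly (R : realFieldType) (k : nat) (x : nat -> R) (j : nat) :
    {poly R} :=
  ((minn j.-1 k)`!%:R)^-1 *: \prod_(maxn 1 (j - k) <= l < j) ('X - (x l)%:P).

Definition spline_piece (R : realFieldType) (k : nat) (x : nat -> R)
    (c : nat -> R) (i : nat) : {poly R} :=
  \sum_(1 <= j < i.+1) c j *: ffpoly k x j.

Lemma horner_ffpoly (R : realFieldType) (k : nat) (x : nat -> R) (j : nat)
    (t : R) :
  (ffpoly k x j).[t] =
  ((minn j.-1 k)`!%:R)^-1 * \prod_(maxn 1 (j - k) <= l < j) (t - x l).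
Proof.
rewrite hornerZ horner_prod; congr (_ * _).
by apply: eq_bigr => l _; rewrite hornerXsubC.
Qed.

Lemma ffbasisE (R : realFieldType) (k : nat) (x : nat -> R) (j : nat) (t : R) :
  ffbasis k x j t =
  (ffpoly k x j).[t] * ((j <= k.+1)%N || (x j.-1 < t))%:R.
Proof.
rewrite horner_ffpoly /ffbasis; case: ifP => le_jk /=.
  have -> : minn j.-1 k = j.-1 by lia.
  by have -> : maxn 1 (j - k) = 1%N; [lia | rewrite mulr1].
have -> : minn j.-1 k = k by lia.
by have -> : maxn 1 (j - k) = (j - k)%N by lia.
Qed.

Lemma size_spline_piece (R : realFieldType) (k : nat) (x c : nat -> R)
    (i : nat) :
  (size (spline_piece k x c i) <= k.+1)%N.
Proof.
apply: leq_trans (size_sum _ _ _) _; apply/bigmax_leqP_seq => j _ _.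
do 2![apply: leq_trans (size_scale_leq _ _) _].
rewrite size_prod_XsubC size_iota; lia.
Qed.

(** Truncation does not alter [h_j] at [t] to the right of its knot, nor at the
    [k] zeros of its polynomial part. Hence the sum of the first [i] polynomial
    parts is the value of the spline at every [t] where each [j <= i] is in one
    of these two cases and the truncation annihilates each [j > i]. *)
Lemma spline_piece_eq (R : realFieldType) (k n : nat) (x c : nat -> R)
    (i : nat) (t : R) :
  (k < i <= n)%N ->
  (forall j, (k.+1 < j <= i)%N ->
     x j.-1 < t \/ exists2 l, (j - k <= l < j)%N & t = x l) ->
  (forall j, (i < j <= n)%N -> t <= x j.-1) ->
  \sum_(1 <= j < n.+1) c j * ffbasis k x j t = (spline_piece k x c i).[t].
Proof.
move=> lt_kin active inactive.
rewrite (big_cat_nat _ (n := i.+1)) /=; [|lia|lia].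
rewrite [X in _ + X]big1_seq ?addr0 => [|j]; last first.
  rewrite mem_index_iota => le_ij; rewrite ffbasisE ltNge inactive; last by lia.
  by have -> : (j <= k.+1)%N = false; [lia | rewrite !mulr0].
rewrite horner_sum; apply: eq_big_nat => j le_ji.
rewrite hornerZ ffbasisE; congr (_ * _).
have [|lt_kj] := leqP j k.+1; first by rewrite mulr1.
have [|->|[l le_l ->]] := active j; [by lia | by rewrite mulr1 |].
by rewrite horner_ffpoly prod_sub_eq0 ?mulr0 ?mul0r //; lia.
Qed.

(** The terms with [m < j <= i] are what the [i]-th piece adds to the [m]-th,
    and each of them vanishes at [x m], because [j - k <= m < j]. *)
Lemma spline_piece_design (R : realFieldType) (k n : nat) (x c : nat -> R)
    (i m : nat) :
  (forall l, (1 <= l < n)%N -> x l < x l.+1) ->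
  (k < i <= n)%N -> (i - k <= m <= i)%N ->
  \sum_(1 <= j < n.+1) c j * ffbasis k x j (x m) =
    (spline_piece k x c i).[x m].
Proof.
move=> x_incr lt_kin le_imi; apply: spline_piece_eq => // j le_j.
  have [le_jm|lt_mj] := leqP j m.
    by left; apply: (@design_lt _ _ _ x_incr); lia.
  by right; exists m => //; lia.
by apply: (@design_le _ _ _ x_incr); lia.
Qed.

(** * Agreement with a discrete spline *)

Lemma next_index_exists (R : realFieldType) (n : nat) (x : nat -> R) (t : R) :
  (0 < n)%N -> t <> x n -> exists i, next_index n x t i.
Proof.
move=> n_gt0 /eqP t_neq.
case: (ltgtP t (x n)) t_neq => // [lt_tn|lt_nt] _; last first.
  by exists n; right.
have ex_i : exists i, (1 <= i <= n)%N && (t < x i).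
  by exists n; rewrite lt_tn n_gt0 leqnn.
case: (ex_minnP ex_i) => i /andP[le_in lt_ti] i_min.
by exists i; left; split=> // j le_jn lt_tj; apply: i_min; rewrite le_jn.
Qed.

(** These bounds place [t] where the spline is its [i]-th piece. That piece is
    still in force beyond [x n], since no basis function has a knot there; this
    is why taking [i = n] is right for such [t]. *)
Lemma next_index_bounds (R : realFieldType) (k n : nat) (x : nat -> R) (t : R)
    (i : nat) :
  (k < n)%N -> (forall l, (1 <= l < n)%N -> x l < x l.+1) ->
  (forall l, (1 <= l <= n)%N -> t <> x l) ->
  x k.+1 < t -> next_index n x t i ->
  [/\ (k < i <= n)%N, forall j, (k.+1 < j <= i)%N -> x j.-1 < t &
      forall j, (i < j <= n)%N -> t <= x j.-1].
Proof.
move=> lt_kn x_incr t_neq lt_kt [[le_in lt_ti i_min]|[-> lt_nt]]; last first.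
  split; [by lia | move=> j ? | by lia].
  by apply: le_lt_trans lt_nt; apply: (@design_le _ _ _ x_incr); lia.
have lt_ki : (k < i)%N.
  rewrite ltnNge; apply/negP => le_ik.
  have : t < x k.+1.
    by apply: lt_le_trans lt_ti _; apply: (@design_le _ _ _ x_incr); lia.
  by rewrite ltNge (ltW lt_kt).
split=> [|j le_j|j le_j]; first by lia.
- have /eqP := t_neq j.-1 ltac:(lia).
  case: (ltgtP t (x j.-1)) => // lt_tj _.
  by have := i_min j.-1 ltac:(lia) lt_tj; lia.
- apply: ltW; apply: lt_le_trans lt_ti _.
  by apply: (@design_le _ _ _ x_incr); lia.
Qed.

(** The spline follows its [i]-th piece both at [t] and at the [k + 1] points
    from which [f] is extrapolated. *)
Lemma divdiff_eq0_spline (R : realFieldType) (k n : nat) (x c : nat -> R)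
    (f : R -> R) (i : nat) (t : R) :
  (forall l, (1 <= l < n)%N -> x l < x l.+1) ->
  (forall m, (1 <= m <= n)%N ->
     \sum_(1 <= j < n.+1) c j * ffbasis k x j (x m) = f (x m)) ->
  (forall m, (1 <= m <= n)%N -> t <> x m) ->
  (k < i <= n)%N ->
  (forall j, (k.+1 < j <= i)%N -> x j.-1 < t) ->
  (forall j, (i < j <= n)%N -> t <= x j.-1) ->
  divdiff f (rcons [seq x l | l <- index_iota (i - k) i.+1] t) = 0 ->
  f t = \sum_(1 <= j < n.+1) c j * ffbasis k x j t.
Proof.
move=> x_incr c_f t_neq lt_kin below above dd0.
rewrite (@spline_piece_eq _ k n x c i t) //; last by move=> j /below; left.
apply: (divdiff_eq0_extrapolate _ dd0).
- rewrite rcons_uniq map_inj_in_uniq ?iota_uniq ?andbT.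
    apply/mapP => -[m]; rewrite mem_index_iota => le_m.
    by apply: t_neq; lia.
  move=> p q; rewrite !mem_index_iota => le_p le_q.
  case: (ltngtP p q) => // [lt_pq|lt_qp] eq_x.
    have := @design_lt _ _ _ x_incr p q ltac:(lia) ltac:(lia).
    by rewrite eq_x ltxx.
  have := @design_lt _ _ _ x_incr q p ltac:(lia) ltac:(lia).
  by rewrite eq_x ltxx.
- have -> : size [seq x l | l <- index_iota (i - k) i.+1] = k.+1.
    by rewrite size_map size_iota; lia.
  exact: size_spline_piece.
- move=> z /mapP[m]; rewrite mem_index_iota => le_m ->.
  by rewrite -(@spline_piece_design _ k n) ?c_f //; lia.
Qed.

Theorem corollary3 (R : realType) (a b : R) (k n : nat) (x : nat -> R)
    (f : R -> R)
    (hkn : (k.+1 <= n)%N)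
    (hax : a <= x 1%N)
    (hx : forall i : nat, (1 <= i < n)%N -> x i < x i.+1)
    (hxb : x n <= b)
    (hf : forall t : R, t \in `[a, b] ->
      (forall i : nat, (1 <= i <= n)%N -> t <> x i) ->
      (x k.+1 < t -> forall i : nat, next_index n x t i ->
         divdiff f (rcons [seq x l | l <- index_iota (i - k) i.+1] t) = 0) /\
      (t < x k.+1 ->
         divdiff f (rcons [seq x l | l <- index_iota 1 k.+2] t) = 0)) :
  discrete_spline a b k n x f /\
  (forall g : R -> R, discrete_spline a b k n x g ->
     (forall i : nat, (1 <= i <= n)%N -> g (x i) = f (x i)) ->
     forall t : R, t \in `[a, b] -> g t = f t).
Proof.
have agree (c : nat -> R) :
    (forall m, (1 <= m <= n)%N ->
       \sum_(1 <= j < n.+1) c j * ffbasis k x j (x m) = f (x m)) ->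
    forall t, t \in `[a, b] ->
      f t = \sum_(1 <= j < n.+1) c j * ffbasis k x j t.
  move=> c_f t t_ab.
  have [/hasP[m]|/hasPn t_design] :=
    boolP (has (fun m => t == x m) (index_iota 1 n.+1)).
    by rewrite mem_index_iota => le_m /eqP ->; rewrite c_f //; lia.
  have t_neq m : (1 <= m <= n)%N -> t <> x m.
    by move=> le_m; apply/eqP/t_design; rewrite mem_index_iota; lia.
  have [dd_right dd_left] := hf t t_ab t_neq.
  have /eqP := t_neq k.+1 ltac:(lia).
  case: (ltgtP t (x k.+1)) => // [lt_tk|lt_kt] _.
    (* Left of all knots the spline is its piece of index [k + 1]. *)
    apply: (@divdiff_eq0_spline _ k n x c f k.+1) => //; try by lia.
    - move=> j le_j; apply: le_trans (ltW lt_tk) _.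
      by apply: (@design_le _ _ _ hx); lia.
    - by rewrite subSnn; apply: dd_left.
  have [||i next_i] := @next_index_exists _ n x t.
  - by lia.
  - by apply: t_neq; lia.
  have [lt_kin below above] :=
    @next_index_bounds _ _ _ _ _ _ hkn hx t_neq lt_kt next_i.
  exact: (@divdiff_eq0_spline _ k n x c f i t hx c_f t_neq lt_kin below above
            (dd_right lt_kt i next_i)).
split.
  have [c c_f] := @ffbasis_interpolation _ k n x (fun i => f (x i)) hx.
  by exists c; apply: agree.
move=> g [c g_c] g_f t t_ab; rewrite g_c // -agree // => m le_m.
rewrite -g_c ?g_f // in_itv /=; apply/andP; split.
- by apply: le_trans hax _; apply: (@design_le _ _ _ hx); lia.
- by apply: le_trans _ hxb; apply: (@design_le _ _ _ hx); lia.
Qed.
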